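(* Let $\mathfrak{B}$ be a bornology on a metric space $X$ with a closed base. Let $\mathcal{I}_1,\mathcal{I}_2,\mathcal{J}_1,\mathcal{J}_2$ be ideals on $\omega$ with $\mathcal{I}_1\leq_\square\mathcal{I}_2$ and $\mathcal{J}_1\leq_\square\mathcal{J}_2$, where $\square\in\{1\text{-}1,KB,K\}$. The following statements hold. (1) If $X$ satisfies $[\mathcal{I}_2\text{-}\Gamma_{\mathfrak{B}^s},\mathcal{J}_1\text{-}\Gamma_{\mathfrak{B}^s}]_\square$, then $X$ satisfies $[\mathcal{I}_1\text{-}\Gamma_{\mathfrak{B}^s},\mathcal{J}_2\text{-}\Gamma_{\mathfrak{B}^s}]_\square$. (2) If $X$ satisfies $[\mathcal{O}_{\mathfrak{B}^s},\mathcal{J}_1\text{-}\Gamma_{\mathfrak{B}^s}]_\square$, then $X$ satisfies $[\mathcal{O}_{\mathfrak{B}^s},\mathcal{J}_2\text{-}\Gamma_{\mathfrak{B}^s}]_\square$, provided $X$ is $\mathfrak{B}^s$-Lindelöf.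
   Context: $(X,d)$ is an infinite metric space; $\omega$ is the set of natural numbers. A bornology $\mathfrak{B}$ on $X$ is a family of subsets of $X$ that is closed under subsets and finite unions and covers $X$. A base of $\mathfrak{B}$ is a subfamily $\mathfrak{B}_0\subseteq\mathfrak{B}$ such that every $B\in\mathfrak{B}$ is contained in some $B_0\in\mathfrak{B}_0$; it is a closed base if its members are closed. For $B\in\mathfrak{B}$, $\delta>0$: $B^\delta=\bigcup_{x\in B}\{y\in X:d(x,y)<\delta\}$. An ideal on $\omega$ is a family $\mathcal{I}\subseteq\mathcal{P}(\omega)$ closed under subsets and finite unions, containing all finite sets, with $\omega\notin\mathcal{I}$. A function $\phi:\omega\to\omega$ is a $1\text{-}1$-function, $KB$-function, $K$-function if it is one-to-one, finite-to-one, arbitrary, respectively. $\mathcal{I}\leq_\square\mathcal{J}$ means there is a $\square$-function $\phi$ with $\phi^{-1}(A)\in\mathcal{J}$ for all $A\in\mathcal{I}$. Covers of $X$ never contain $X$ as an element. A cover $\mathcal{U}$ of $X$ is a $\mathfrak{B}^s$-cover if for each $B\in\mathfrak{B}$ there are $U\in\mathcal{U}$ and $\delta>0$ with $B^\delta\subseteq U$; it is an open $\mathfrak{B}^s$-cover if its members are open. $\mathcal{O}_{\mathfrak{B}^s}$ is the class of open $\mathfrak{B}^s$-covers of $X$. $X$ is $\mathfrak{B}^s$-Lindelöf if every $\mathfrak{B}^s$-cover of $X$ contains a countable subset which is a $\mathfrak{B}^s$-cover of $X$. A countable open cover $\{U_n:n\in\omega\}$ (with its enumeration) is an $\mathcal{I}$-$\gamma_{\mathfrak{B}^s}$-cover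 if for each $B\in\mathfrak{B}$ there is a sequence $\{\delta_n\}$ of positive reals with $\{n\in\omega:B^{\delta_n}\nsubseteq U_n\}\in\mathcal{I}$; $\mathcal{I}\text{-}\Gamma_{\mathfrak{B}^s}$ is the class of these. $[\mathcal{P},\mathcal{R}]_\square$: for every sequence $\{V_n:n\in\omega\}\in\mathcal{P}$ there is a $\square$-function $\phi:\omega\to\omega$ such that $\{V_{\phi(n)}:n\in\omega\}\in\mathcal{R}$. *)

(* Defs.v *)
From mathcomp Require Import all_boot all_order all_algebra.
From mathcomp Require Import all_classical all_reals all_analysis.

Set Implicit Arguments.
Unset Strict Implicit.
Unset Printing Implicit Defensive.

Import Order.TTheory GRing.Theory Num.Theory.
Local Open Scope classical_set_scope.
Local Open Scope ring_scope.

(* Closure under the empty union is [bornology_set0]; binary unions give the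
   other finite ones. *)
Record is_bornology (X : Type) (B : set (set X)) : Prop := IsBornology {
  bornology_sub : forall A C : set X, B C -> A `<=` C -> B A;
  bornology_set0 : B set0;
  bornology_setU : forall A C : set X, B A -> B C -> B (A `|` C);
  bornology_cover : \bigcup_(A in B) A = setT
}.

Definition is_base (X : Type) (B B0 : set (set X)) : Prop :=
  B0 `<=` B /\ forall A, B A -> exists2 A0, B0 A0 & A `<=` A0.

Definition has_closed_base (X : topologicalType) (B : set (set X)) : Prop :=
  exists2 B0, is_base B B0 & forall A, B0 A -> closed A.

Record is_ideal (I : set (set nat)) : Prop := IsIdeal {
  ideal_sub : forall A C : set nat, I C -> A `<=` C -> I A;
  ideal_setU : forall A C : set nat, I A -> I C -> I (A `|` C);
  ideal_finite : forall A : set nat, finite_set A -> I A;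
  ideal_proper : ~ I setT
}.

Inductive fun_kind : Set := OneToOne | KB | K.

Definition is_kind (k : fun_kind) (phi : nat -> nat) : Prop :=
  match k with
  | OneToOne => injective phi
  | KB => forall n, finite_set (phi @^-1` [set n])
  | K => True
  end.

Definition ideal_le (k : fun_kind) (I J : set (set nat)) : Prop :=
  exists2 phi, is_kind k phi & forall A, I A -> J (phi @^-1` A).

Section Covers.
Context {R : realType} {X : metricType R}.
Implicit Types (B U : set (set X)) (V : nat -> set X).

Definition enlargement (A : set X) (delta : R) : set X :=
  \bigcup_(x in A) [set y | mdist x y < delta].

Definition is_cover U : Prop := \bigcup_(A in U) A = setT /\ ~ U setT.

Definition bs_cover B : set (set (set X)) := [set U | is_cover U /\
  forall A, B A ->
    exists2 W, U W & exists2 delta : R, 0 < delta & enlargement A delta `<=` W].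

Definition open_bs_cover B : set (set (set X)) :=
  [set U | bs_cover B U /\ forall W, U W -> open W].

Definition bs_lindelof B : Prop := forall U, bs_cover B U ->
  exists U', [/\ U' `<=` U, countable U' & bs_cover B U'].

(* Classes of countable covers are represented by their enumerations, i.e. as
   sets of sequences; enumerations may repeat members. *)
Definition enumerations (C : set (set (set X))) : set (nat -> set X) :=
  [set V | C (range V)].

Definition Obs B : set (nat -> set X) := enumerations (open_bs_cover B).

Definition Gamma_bs (I : set (set nat)) B : set (nat -> set X) :=
  [set V | [/\ is_cover (range V), (forall n, open (V n)) &
    forall A, B A -> exists2 delta : nat -> R, (forall n, 0 < delta n) &
      I [set n | ~ (enlargement A (delta n) `<=` V n)]]].

Definition selection (k : fun_kind) (P Q : set (nat -> set X)) : Prop :=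
  forall V, P V -> exists2 phi, is_kind k phi & Q (V \o phi).

End Covers.

(* Main.v *)
Require Import Defs.
From mathcomp Require Import all_boot all_order all_algebra.
From mathcomp Require Import all_classical all_reals all_analysis.
Local Open Scope classical_set_scope.

(** Reindexing a cover along a witness [phi] of [I <= J] turns an
    [I]-gamma cover into a [J]-gamma cover: the exceptional set of [V \o phi]
    at a member of the bornology is the [phi]-preimage of the exceptional set
    of [V], so it lies in [J] ([Gamma_bs_comp]). The one delicate point is that
    the reindexed sequence still covers the space. This holds because
    singletons belong to every bornology and [J] is proper, so each point lies
    in [V (phi n)] for some (indeed [J]-almost every) [n].

    Both parts then follow since functions of a given kind are closed under
    composition ([is_kind_comp]). Given [V], reindex it from [I1] to [I2] for
    part (1), apply the assumed selection principle to the result (or, for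
    part (2), to [V] itself), and finally reindex from [J1] to [J2]. *)

(** The finite-to-one case reduces to a fibre of a composite being a finite
    union of fibres. *)
Lemma is_kind_comp {k : fun_kind} {phi psi : nat -> nat} :
  is_kind k phi -> is_kind k psi -> is_kind k (phi \o psi).
Proof.
case: k => //= [|phi_fin psi_fin n]; first exact: inj_comp.
have -> : (phi \o psi) @^-1` [set n] =
    \bigcup_(m in phi @^-1` [set n]) psi @^-1` [set m].
  apply/seteqP; split => [i /= phi_i|i [m /= phi_m psi_i]].
    by exists (psi i).
  by rewrite /= psi_i.
exact: bigcup_finite.
Qed.

Lemma bornology_set1 {X : Type} {B : set (set X)} (x : X) :
  is_bornology B -> B [set x].
Proof.
move=> B_born.
have [A BA Ax] : (\bigcup_(A in B) A) x by rewrite (bornology_cover B_born).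
by apply: (bornology_sub B_born BA) => _ ->.
Qed.

Lemma sub_enlargement {R : realType} {X : metricType R} {A : set X}
    {delta : R} :
  (0 < delta)%R -> A `<=` enlargement A delta.
Proof. by move=> delta_gt0 x Ax; exists x => //=; rewrite mdistxx. Qed.

Lemma ideal_proper_exists {J : set (set nat)} {P : set nat} :
  is_ideal J -> J [set n | ~ P n] -> exists n, P n.
Proof.
move=> J_ideal JP; apply: contrapT => noP.
apply: (ideal_proper J_ideal); apply: (ideal_sub J_ideal JP) => n _ Pn.
by apply: noP; exists n.
Qed.

(** Covering by [V \o phi] does not come from covering by [V]; it comes from
    applying the gamma condition to singletons and using that [J] is proper. *)
Lemma Gamma_bs_comp {R : realType} {X : metricType R} {B : set (set X)}
    {I J : set (set nat)} {V : nat -> set X} {phi : nat -> nat} :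
  is_bornology B -> is_ideal J -> (forall A, I A -> J (phi @^-1` A)) ->
  Gamma_bs I B V -> Gamma_bs J B (V \o phi).
Proof.
move=> B_born J_ideal phiIJ [[_ V_proper] V_open V_gamma].
have gamma A : B A -> exists2 delta : nat -> R, (forall n, 0 < delta n)%R &
    J [set n | ~ (enlargement A (delta n) `<=` (V \o phi) n)].
  move=> /V_gamma[delta delta_gt0 /phiIJ Jdelta].
  by exists (delta \o phi) => // n; exact: delta_gt0.
split=> //; last by move=> n; exact: V_open.
split; last by case=> n _ VnT; apply: V_proper; exists (phi n).
apply/seteqP; split=> // x _.
have [delta delta_gt0 Jdelta] := gamma _ (bornology_set1 x B_born).
have [n Vn] := ideal_proper_exists J_ideal Jdelta.
exists ((V \o phi) n); first by exists n.
exact/Vn/(sub_enlargement (delta_gt0 n)).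
Qed.

Lemma selection_ideal_le {R : realType} {X : metricType R} {B : set (set X)}
    {P : set (nat -> set X)} {k : fun_kind} {J1 J2 : set (set nat)} :
  is_bornology B -> is_ideal J2 -> ideal_le k J1 J2 ->
  selection k P (Gamma_bs J1 B) -> selection k P (Gamma_bs J2 B).
Proof.
move=> B_born J2_ideal [chi k_chi chiJ] sel V /sel[psi k_psi VJ1].
exists (psi \o chi); first exact: is_kind_comp.
exact: (Gamma_bs_comp B_born J2_ideal chiJ VJ1).
Qed.

Theorem theorem3p8 (R : realType) (X : metricType R)
    (X_infinite : infinite_set [set: X])
    (B : set (set X)) (B_born : is_bornology B) (B_base : has_closed_base B)
    (I1 I2 J1 J2 : set (set nat))
    (I1_ideal : is_ideal I1) (I2_ideal : is_ideal I2)
    (J1_ideal : is_ideal J1) (J2_ideal : is_ideal J2)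
    (k : fun_kind) (I12 : ideal_le k I1 I2) (J12 : ideal_le k J1 J2) :
  (selection k (Gamma_bs I2 B) (Gamma_bs J1 B) ->
     selection k (Gamma_bs I1 B) (Gamma_bs J2 B)) /\
  (bs_lindelof B ->
     selection k (Obs B) (Gamma_bs J1 B) ->
     selection k (Obs B) (Gamma_bs J2 B)).
Proof.
split=> [sel|_]; last exact: selection_ideal_le.
apply: (selection_ideal_le B_born J2_ideal J12) => V VI1.
have [phi k_phi phiI] := I12.
have [psi k_psi VJ1] := sel _ (Gamma_bs_comp B_born I2_ideal phiI VI1).
by exists (phi \o psi) => //; exact: is_kind_comp.
Qed.
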